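(* Let $a<b$ be real numbers, let $m>0$ be real and let $\sigma\in\mathcal{A}(m)$. Let $f_0:[a,b]\to\mathbb{E}^1$ be a level continuous function. Then, for every $\lambda\in[0,1]$, every $n\in\mathbb{N}$, $n\ge 1$, and every $x\in[a,b]$, $$d_H\big([f_0(x)]^{\lambda},[S_{n,\sigma}(f_0,x)]^{\lambda}\big)\leq \omega^{\mathcal{F}}(f_0,h,\lambda),\qquad\text{where } h=\frac{b-a}{n}.$$
   Context: Fuzzy numbers: for $u:\mathbb{R}\to[0,1]$ put $[u]^{\lambda}=\{x\in\mathbb{R}: u(x)\ge\lambda\}$ for $\lambda\in(0,1]$ and $[u]^0=\overline{\{x\in\mathbb{R}: u(x)>0\}}$. A fuzzy number is a function $u:\mathbb{R}\to[0,1]$ such that: there is $x$ with $u(x)=1$; $u$ is upper semicontinuous; $u(\alpha x+(1-\alpha)y)\ge\min\{u(x),u(y)\}$ for all $x,y\in\mathbb{R}$, $\alpha\in[0,1]$; and $[u]^0$ is compact. $\mathbb{E}^1$ is the set of fuzzy numbers. For $u\in\mathbb{E}^1$ each level is a nonempty compact interval, written $[u]^\lambda=[u^-(\lambda),u^+(\lambda)]$. Arithmetic: for $u,v\in\mathbb{E}^1$ and $c\in\mathbb{R}$, $u+v$ and $cu$ are the fuzzy numbers determined levelwise by $[u+v]^\lambda=[u]^\lambda+[v]^\lambda$ (Minkowski sum) and $[cu]^\lambda=c[u]^\lambda$, $\lambda\in[0,1]$. $d_H$ is the Hausdorff distance between nonempty compact subsets of $\mathbb{R}$; for intervals $d_H([u]^\lambda,[v]^\lambda)=\max\{|u^-(\lambda)-v^-(\lambda)|,|u^+(\lambda)-v^+(\lambda)|\}$.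 Class $\mathcal{A}(m)$: for real $m>0$, $\sigma\in\mathcal{A}(m)$ means $\sigma:\mathbb{R}\to\mathbb{R}$ is nondecreasing with $\sigma(x)=0$ for $x\le -m$ and $\sigma(x)=1$ for $x\ge m$. Put $\varphi(x)=\sigma(x+m)-\sigma(x-m)$. Operator: for $f:[a,b]\to\mathbb{E}^1$, $x\in[a,b]$ and $n\ge1$, $$S_{n,\sigma}(f,x)=\sum_{k=0}^{n}\varphi\Big(\frac{2m}{h}(x-x_k)\Big)f(x_k),\qquad h=\frac{b-a}{n},\quad x_k=a+kh.$$ Level continuity: $f:[a,b]\to\mathbb{E}^1$ is level continuous if for every $\lambda\in[0,1]$ the real functions $x\mapsto f(x)^-(\lambda)$ and $x\mapsto f(x)^+(\lambda)$ are continuous on $[a,b]$. Levelwise fuzzy modulus of continuity: $\omega^{\mathcal{F}}(f,\delta,\lambda)=\sup\{d_H([f(x)]^\lambda,[f(y)]^\lambda): x,y\in[a,b],\ |x-y|<\delta\}$. *)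

(* Defs.v *)
From HB Require Import structures.
From mathcomp Require Import all_boot all_order all_algebra.
From mathcomp Require Import all_classical all_reals all_analysis.
From mathcomp Require Import ring lra.

Set Implicit Arguments.
Unset Strict Implicit.
Unset Printing Implicit Defensive.

Import Order.TTheory GRing.Theory Num.Theory.
Import numFieldNormedType.Exports.

Local Open Scope classical_set_scope.
Local Open Scope ring_scope.

Section fuzzy_numbers.
Context {R : realType}.
Implicit Types (u v : R -> R) (A B : set R) (x y c l : R).

Definition upper_semicontinuous u :=
  forall x c, u x < c -> \forall y \near x, u y < c.

Definition level u l : set R :=
  if l == 0 then closure [set x | 0 < u x] else [set x | l <= u x].

Record is_fuzzy_number u : Prop := IsFuzzyNumber {
  fuzzy_ge0_le1 : forall x, 0 <= u x <= 1 ;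
  fuzzy_normal : exists x, u x = 1 ;
  fuzzy_usc : upper_semicontinuous u ;
  fuzzy_quasiconcave : forall x y c, 0 <= c <= 1 ->
    Num.min (u x) (u y) <= u (c * x + (1 - c) * y) ;
  fuzzy_compact : compact (level u 0) }.

Record fuzzy_number := FuzzyNumber {
  membership :> R -> R ;
  fuzzy_numberP : is_fuzzy_number membership }.

HB.instance Definition _ := gen_eqMixin fuzzy_number.
HB.instance Definition _ := gen_choiceMixin fuzzy_number.

Lemma fuzzy_ext (p q : fuzzy_number) : p =1 q -> p = q.
Proof.
case: p q => [p Pp] [q Pq] /= /funext pq; case: _ / pq Pq => Pq.
by congr FuzzyNumber; exact: Prop_irrelevance.
Qed.

Definition level_lo u l : R := inf (level u l).
Definition level_hi u l : R := sup (level u l).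

Lemma level0 u : level u 0 = closure [set x | 0 < u x].
Proof. by rewrite /level eqxx. Qed.

Lemma level_gt0 u l : 0 < l -> level u l = [set x | l <= u x].
Proof. by move=> l0; rewrite /level gt_eqF. Qed.

Lemma level_closed u l : is_fuzzy_number u -> closed (level u l).
Proof.
move=> [_ _ usc _ _]; rewrite /level; case: ifPn => _.
  exact: closed_closure.
rewrite (_ : [set x | _] = ~` [set x | u x < l]); last first.
  by apply/seteqP; split=> x /=; rewrite leNgt => /negP.
apply: open_closedC; rewrite openE => x /= ux.
by rewrite /interior; exact: usc.
Qed.

Lemma level_subset u l l' : is_fuzzy_number u -> 0 <= l -> l <= l' ->
  level u l' `<=` level u l.
Proof.
move=> _ l0 ll' x; rewrite /level.
have [l'0|l'n0] := eqVneq l' 0.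
  have -> : l = 0 by apply/le_anti; rewrite l0 -l'0 ll'.
  by rewrite eqxx.
move=> /= ux; case: ifPn => [_|_] /=; last exact: le_trans ux.
apply: subset_closure => /=; apply: lt_le_trans ux.
by rewrite lt_neqAle eq_sym l'n0 (le_trans l0).
Qed.

Lemma quasiconcave_interval u l : is_fuzzy_number u ->
  is_interval [set x | l <= u x].
Proof.
move=> [_ _ _ qc _] x y /= lx ly z /andP[xz zy].
have [xy|xy] := ltP x y; last first.
  by have -> : z = x by apply/le_anti; rewrite xz (le_trans zy).
have yx0 : y - x != 0 by rewrite gt_eqF ?subr_gt0.
have -> : z = (y - z) / (y - x) * x + (1 - (y - z) / (y - x)) * y by field.
apply: (le_trans _ (qc _ _ _ _)); first by rewrite le_min lx ly.
apply/andP; split; first by rewrite divr_ge0 ?subr_ge0// ltW.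
by rewrite ler_pdivrMr ?subr_gt0// mul1r lerD2l lerN2.
Qed.

Lemma level_is_interval u l : is_fuzzy_number u -> is_interval (level u l).
Proof.
move=> fu; rewrite /level; case: ifPn => _; last exact: quasiconcave_interval.
apply/connected_intervalP; apply: connected_closure.
apply/connected_intervalP => x y /= ux uy z xzy.
have := @quasiconcave_interval u (Num.min (u x) (u y)) fu x y.
rewrite /= ge_min lexx ge_min lexx orbT => /(_ isT isT _ xzy).
by apply: lt_le_trans; rewrite lt_min ux.
Qed.

Lemma level_nonempty u l : is_fuzzy_number u -> 0 <= l <= 1 -> level u l !=set0.
Proof.
move=> fu /andP[l0 l1]; have [x ux] := fuzzy_normal fu; exists x.
by apply: (level_subset fu l0 l1); rewrite level_gt0//= ux.
Qed.

Lemma level_bounded u l : is_fuzzy_number u -> 0 <= l ->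
  has_lbound (level u l) /\ has_ubound (level u l).
Proof.
move=> fu l0; have [M [_ HM]] := compact_bounded (fuzzy_compact fu).
have {}HM x : level u l x -> `|x| <= M + 1.
  by move=> /(level_subset fu (lexx 0) l0); apply: HM; rewrite ltrDl.
by split; [exists (- (M + 1))|exists (M + 1)] => x /HM; rewrite ler_norml => /andP[].
Qed.

Lemma closure_realP A x :
  closure A x <-> forall e, 0 < e -> exists2 y, A y & `|x - y| < e.
Proof.
split=> [clA e e0|clA B /nbhs_ballP[e /= e0 eB]].
  by have [y [Ay xy]] := clA _ (nbhsx_ballx x e e0); exists y.
by have [y Ay xy] := clA _ e0; exists y; split=> //; exact: eB.
Qed.

Lemma closure_inf A : A !=set0 -> has_lbound A -> closure A (inf A).
Proof.
move=> A0 lA; apply/closure_realP => e e0.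
have [x Ax xe] := inf_adherent e0 (conj A0 lA); exists x => //.
by have := ge_inf lA Ax; rewrite ltr_distl; lra.
Qed.

Lemma level_segment u l : is_fuzzy_number u -> 0 <= l <= 1 ->
  level u l = `[level_lo u l, level_hi u l]%classic.
Proof.
move=> fu l01; have /andP[l0 l1] := l01.
have [lb ub] := level_bounded fu l0; have ne := level_nonempty fu l01.
have cl := level_closed (l := l) fu.
apply/seteqP; split=> x.
  by move=> lx; rewrite /= in_itv /=; apply/andP; split;
    [exact: ge_inf|exact: ub_le_sup].
rewrite /= in_itv /= => xI.
have hlo : level u l (level_lo u l).
  by rewrite (iffLR (closure_id _) cl); apply: closure_inf.
have hhi : level u l (level_hi u l).
  by rewrite (iffLR (closure_id _) cl); apply: closure_sup.
exact: (level_is_interval fu hlo hhi).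
Qed.

Lemma level_lo_le_hi u l : is_fuzzy_number u -> 0 <= l <= 1 ->
  level_lo u l <= level_hi u l.
Proof.
move=> fu l01; have [x] := level_nonempty fu l01.
by rewrite level_segment//= in_itv/= => /andP[]; exact: le_trans.
Qed.

Lemma fuzzy_eq_level (p q : fuzzy_number) :
  (forall l, 0 <= l <= 1 -> level p l = level q l) -> p = q.
Proof.
have key (p' q' : fuzzy_number) :
    (forall l, 0 <= l <= 1 -> level p' l = level q' l) -> forall x, p' x <= q' x.
  move=> pq x; have /andP[p0 p1] := fuzzy_ge0_le1 (fuzzy_numberP p') x.
  have /andP[q0 _] := fuzzy_ge0_le1 (fuzzy_numberP q') x.
  have [p00|pn0] := eqVneq (p' x) 0; first by rewrite p00.
  have pp0 : 0 < p' x by rewrite lt_neqAle eq_sym pn0.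
  have : level p' (p' x) x by rewrite level_gt0//=.
  by rewrite pq ?p0// level_gt0.
by move=> pq; apply: fuzzy_ext => x; apply/le_anti; rewrite !key// => l /pq.
Qed.

Lemma is_fuzzy_number_levels u (K : set R) :
    (forall x, 0 <= u x <= 1) -> (exists x, u x = 1) ->
    (forall l, 0 < l <= 1 -> closed [set x | l <= u x]) ->
    (forall l, 0 < l <= 1 -> is_interval [set x | l <= u x]) ->
    compact K -> [set x | 0 < u x] `<=` K ->
  is_fuzzy_number u.
Proof.
move=> u01 u1 ucl uit cK uK; split => //.
- move=> x c uxc.
  have /andP[ux0 _] := u01 x.
  have c0 : 0 < c by exact: le_lt_trans uxc.
  have [c1|c1] := leP c 1; last first.
    by near=> y; apply: le_lt_trans c1; have /andP[] := u01 y.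
  have := ucl _ (introT andP (conj c0 c1)).
  move=> /closed_openC oC.
  have : nbhs x (~` [set y | c <= u y]).
    by apply: open_nbhs_nbhs; split=> //=; apply/negP; rewrite -ltNge.
  by apply: filterS => y /= /negP; rewrite -ltNge.
- move=> x y c /andP[c0 c1].
  have /andP[x0 x1] := u01 x; have /andP[y0 y1] := u01 y.
  set l := Num.min _ _.
  have [l0|l0] := leP l 0.
    by apply: (le_trans l0); case/andP: (u01 (c * x + (1 - c) * y)).
  have l1 : l <= 1 by rewrite /l ge_min x1.
  have lx : l <= u x by rewrite /l ge_min lexx.
  have ly : l <= u y by rewrite /l ge_min lexx orbT.
  have il := uit _ (introT andP (conj l0 l1)).
  have [xy|/ltW yx] := leP x y.
  + by apply: (il x y) => //; nra.
  + by apply: (il y x) => //; nra.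
- rewrite level0; apply: (subclosed_compact _ cK); first exact: closed_closure.
  rewrite (_ : K = closure K); first exact: closure_subset.
  by apply/closure_id; apply: compact_closed.
Unshelve. all: by end_near. Qed.

(* The indicator of {0} when c = 0; level_scale below gives the level sets. *)
Definition fuzzy_scale_fun c u : R -> R :=
  fun x => if c == 0 then (x == 0)%:R else u (x / c).

Definition minkowski A B : set R := [set x + y | x in A & y in B].

(* The extension principle; level_add below gives the level sets, which
   determine the sum by fuzzy_eq_level. *)
Definition fuzzy_add_fun u v : R -> R :=
  fun x => sup [set Num.min (u y) (v (x - y)) | y in [set: R]].

Definition fuzzy_zero_fun : R -> R := fun x => (x == 0)%:R.

Lemma fuzzy_zero_subproof : is_fuzzy_number fuzzy_zero_fun.
Proof.
have lev l : 0 < l <= 1 -> [set x | l <= fuzzy_zero_fun x] = [set 0].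
  move=> /andP[l0 l1]; apply/seteqP; split=> x /=; rewrite /fuzzy_zero_fun.
    by case: eqVneq => //= _; rewrite leNgt l0.
  by move=> ->; rewrite eqxx.
apply: (@is_fuzzy_number_levels _ [set 0]).
- by move=> x; rewrite /fuzzy_zero_fun; case: eqP; rewrite ?lexx ?ler01.
- by exists 0; rewrite /fuzzy_zero_fun eqxx.
- by move=> l /lev ->; exact: closed_eq.
- move=> l /lev -> x y /= -> -> z.
  by move=> z0; apply/le_anti; rewrite andbC.
- exact: compact_set1.
- by move=> x /=; rewrite /fuzzy_zero_fun; case: eqVneq => //=; rewrite ltxx.
Qed.

Definition fuzzy_zero := FuzzyNumber fuzzy_zero_subproof.

Lemma level_zero l : 0 <= l <= 1 -> level fuzzy_zero l = [set 0].
Proof.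
move=> /andP[l0 l1]; have [->|ln0] := eqVneq l 0.
  rewrite level0 (_ : [set x | _] = [set 0]).
    by rewrite -(iffLR (closure_id _) (@closed_eq _ 0)).
  apply/seteqP; split=> x /=; rewrite /fuzzy_zero_fun.
    by case: eqVneq => //=; rewrite ltxx.
  by move=> ->; rewrite eqxx.
rewrite level_gt0 ?lt_neqAle 1?eq_sym ?ln0//.
apply/seteqP; split=> x /=; rewrite /fuzzy_zero_fun.
  case: eqVneq => //= _ ll0; case/eqP: ln0.
  by apply/le_anti; rewrite l0 ll0.
by move=> ->; rewrite eqxx.
Qed.

Lemma fuzzy_scale_subproof c (p : fuzzy_number) :
  is_fuzzy_number (fuzzy_scale_fun c p).
Proof.
have [->|c0] := eqVneq c 0.
  rewrite (_ : fuzzy_scale_fun _ _ = fuzzy_zero_fun); first exact: fuzzy_zero_subproof.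
  by apply/funext => x; rewrite /fuzzy_scale_fun eqxx.
rewrite (_ : fuzzy_scale_fun _ _ = fun x => p (x / c)); last first.
  by apply/funext => x; rewrite /fuzzy_scale_fun (negbTE c0).
have fp := fuzzy_numberP p.
apply: (@is_fuzzy_number_levels _ ( *%R c @` level p 0)).
- by move=> x; exact: (fuzzy_ge0_le1 fp).
- have [x px] := fuzzy_normal fp; exists (c * x).
  by rewrite mulrAC divff// mul1r.
- move=> l /andP[l0 _].
  apply: (@closed_comp _ _ (fun x => x / c) [set x | l <= p x]).
    by move=> x _; exact: mulrr_continuous.
  by rewrite -level_gt0//; exact: level_closed.
- move=> l /andP[l0 _] x y /= lx ly z /andP[xz zy].
  have pint := @quasiconcave_interval _ l fp.
  have [cp|cn] := ltP 0 c.
    by apply: (pint _ _ lx ly); rewrite !ler_pM2r ?invr_gt0// xz.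
  have {}cn : c < 0 by rewrite lt_neqAle c0.
  by apply: (pint _ _ ly lx); rewrite !ler_nM2r ?invr_lt0// xz zy.
- apply: continuous_compact; last exact: fuzzy_compact.
  by apply: continuous_subspaceT => x; exact: mulrl_continuous.
- move=> x /= px; exists (x / c); last by rewrite mulrC divfK.
  by rewrite level0; exact: subset_closure.
Qed.

Definition fuzzy_scale c p := FuzzyNumber (fuzzy_scale_subproof c p).

Lemma level_scale c (p : fuzzy_number) l : 0 <= l <= 1 ->
  level (fuzzy_scale c p) l = *%R c @` level p l.
Proof.
move=> l01; have fp := fuzzy_numberP p.
have [->|c0] := eqVneq c 0.
  rewrite (_ : fuzzy_scale 0 p = fuzzy_zero); last first.
    by apply: fuzzy_ext => x; rewrite /= /fuzzy_scale_fun eqxx.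
  rewrite level_zero//; apply/seteqP; split=> x /= => [->|[y _ <-]].
    by have [y py] := level_nonempty fp l01; exists y => //; rewrite mul0r.
  by rewrite mul0r.
have {l01}/andP[l0 l1] := l01.
have scE x : fuzzy_scale_fun c p x = p (x / c) by rewrite /fuzzy_scale_fun (negbTE c0).
have cVK x : c * (x / c) = x by rewrite mulrC divfK.
have cK x : c * x / c = x by rewrite mulrAC divff// mul1r.
have [ll0|ln0] := eqVneq l 0; last first.
  have {ln0}l0' : 0 < l by rewrite lt_neqAle eq_sym ln0.
  rewrite !level_gt0//; apply/seteqP; split=> x /=.
    by rewrite scE => px; exists (x / c).
  by move=> [y py <-]; rewrite scE cK.
rewrite ll0 !level0; apply/seteqP; split=> x.
  move=> /closure_realP clx; exists (x / c) => //; apply/closure_realP => e e0.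
  have [|y] := clx (e * `|c|); first by rewrite mulr_gt0// normr_gt0.
  rewrite /= scE => py xy; exists (y / c) => //.
  by rewrite -mulrBl normrM normfV ltr_pdivrMr// normr_gt0.
move=> [{}x /closure_realP clx <-]; apply/closure_realP => e e0.
have [|y py xy] := clx (e / `|c|); first by rewrite divr_gt0// normr_gt0.
exists (c * y); first by rewrite /= scE cK.
by rewrite -mulrBr normrM mulrC -ltr_pdivlMr// normr_gt0.
Qed.

Lemma fuzzy_add_fun_ge u v x y : is_fuzzy_number u -> is_fuzzy_number v ->
  Num.min (u y) (v (x - y)) <= fuzzy_add_fun u v x.
Proof.
move=> fu fv; apply: ub_le_sup; last by exists y.
exists 1 => _ [z _ <-]; rewrite ge_min.
by have /andP[_ ->] := fuzzy_ge0_le1 fu z.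
Qed.

Lemma fuzzy_add_fun_gt u v x l : l < fuzzy_add_fun u v x ->
  exists y, l < u y /\ l < v (x - y).
Proof.
move=> /sup_gt[|_ [y _ <-]]; last by rewrite lt_min => /andP[]; exists y.
by exists (Num.min (u 0) (v (x - 0))); exists 0.
Qed.

Lemma fuzzy_add_fun01 u v x : is_fuzzy_number u -> is_fuzzy_number v ->
  0 <= fuzzy_add_fun u v x <= 1.
Proof.
move=> fu fv; apply/andP; split.
  apply: (le_trans _ (fuzzy_add_fun_ge x 0 fu fv)); rewrite le_min.
  by have /andP[-> _] := fuzzy_ge0_le1 fu 0; have /andP[] := fuzzy_ge0_le1 fv (x - 0).
apply: ge_sup; first by exists (Num.min (u 0) (v (x - 0))); exists 0.
move=> _ [z _ <-]; rewrite ge_min.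
by have /andP[_ ->] := fuzzy_ge0_le1 fu z.
Qed.

(* The supremum defining (u + v) x is attained: if it is at least l, then the
   segments [u]^t `&` (x - [v]^t), 0 < t < l, are nonempty and nested, and the
   supremum of their left endpoints lies in all of them. *)
Lemma fuzzy_add_fun_level u v l : is_fuzzy_number u -> is_fuzzy_number v ->
  0 < l <= 1 ->
  [set x | l <= fuzzy_add_fun u v x] = minkowski (level u l) (level v l).
Proof.
move=> fu fv /andP[l0 l1]; apply/seteqP; split=> x /=; last first.
  rewrite !level_gt0// => -[y /= ly] [z /= lz <-].
  apply: (le_trans _ (fuzzy_add_fun_ge _ y fu fv)).
  by rewrite le_min ly addrC addKr.
move=> lx; pose L t := Num.max (level_lo u t) (x - level_hi v t).
pose H t := Num.min (level_hi u t) (x - level_lo v t).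
have memE t y : 0 < t -> t < l ->
    (t <= u y /\ t <= v (x - y)) <-> (L t <= y /\ y <= H t).
  move=> t0 tl; have t01 : 0 <= t <= 1 by rewrite (ltW t0) (le_trans (ltW tl)).
  have := level_segment fu t01; have := level_segment fv t01.
  rewrite !level_gt0// => /seteqP[v1 v2] /seteqP[u1 u2].
  move: (v1 (x - y)) (v2 (x - y)) (u1 y) (u2 y); rewrite /= !in_itv /= => {}v1 {}v2 {}u1 {}u2.
  rewrite /L /H ge_max le_min; split.
    by move=> [/u1/andP[-> ->] /v1/andP[vl vr]]; split; lra.
  move=> [/andP[a1 a2] /andP[a3 a4]]; split; first by apply: u2; rewrite a1.
  by apply: v2; apply/andP; split; lra.
have LH t s : 0 < t -> t < l -> 0 < s -> s < l -> L s <= H t.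
  move=> t0 tl s0 sl.
  have tm : Num.max t s < l by rewrite gt_max tl.
  have [y [uy vy]] := fuzzy_add_fun_gt (lt_le_trans tm lx).
  have [|_ yt] := iffLR (memE t y t0 tl).
    by move: uy vy; rewrite !gt_max => /andP[/ltW-> _] /andP[/ltW-> _].
  have [|sy _] := iffLR (memE s y s0 sl).
    by move: uy vy; rewrite !gt_max => /andP[_ /ltW->] /andP[_ /ltW->].
  exact: le_trans yt.
pose E := [set L t | t in [set t | 0 < t < l]].
have Eh : E (L (l / 2)) by exists (l / 2) => //=; apply/andP; split; lra.
have EH t : 0 < t -> t < l -> ubound E (H t).
  by move=> t0 tl _ [s /= /andP[s0 sl] <-]; exact: LH.
have sE t : 0 < t -> t < l -> t <= u (sup E) /\ t <= v (x - sup E).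
  move=> t0 tl; apply/memE => //; split.
    apply: ub_le_sup; last by exists t => //=; rewrite t0.
    by exists (H t); exact: EH.
  by apply: ge_sup; [exists (L (l / 2))|exact: EH].
have lim (r : R) : (forall t, 0 < t -> t < l -> t <= r) -> l <= r.
  move=> tr; rewrite leNgt; apply/negP => rl.
  have := tr (Num.max (l / 2) ((l + r) / 2)).
  rewrite lt_max gt_max ge_max.
  by move=> /(_ _ _)/andP[]; [apply/orP; left; lra|apply/andP; split; lra|lra].
exists (sup E); first by rewrite level_gt0//=; apply: lim => t /sE/[apply]-[].
exists (x - sup E); last by rewrite addrC subrK.
by rewrite level_gt0//=; apply: lim => t /sE/[apply]-[].
Qed.

Lemma minkowski_segment (a b c d : R) : a <= b -> c <= d ->
  minkowski `[a, b] `[c, d] = `[a + c, b + d]%classic.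
Proof.
move=> ab cd; apply/seteqP; split=> x /=.
  move=> [y + [z + <-]]; rewrite /= !in_itv /= => /andP[? ?] /andP[? ?].
  by apply/andP; split; lra.
rewrite in_itv /= => /andP[acx xbd].
have [xad|xad] := leP x (a + d).
  exists a; first by rewrite /= in_itv /= lexx.
  by exists (x - a); [rewrite /= in_itv /=; apply/andP; split; lra|ring].
exists (x - d); first by rewrite /= in_itv /=; apply/andP; split; lra.
by exists d; [rewrite /= in_itv /= lexx cd|ring].
Qed.

Lemma minkowski_level_segment u v l : is_fuzzy_number u -> is_fuzzy_number v ->
  0 <= l <= 1 -> minkowski (level u l) (level v l) =
    `[level_lo u l + level_lo v l, level_hi u l + level_hi v l]%classic.
Proof.
move=> fu fv l01; rewrite (level_segment fu l01) (level_segment fv l01).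
by rewrite minkowski_segment//; exact: level_lo_le_hi.
Qed.

Lemma fuzzy_add_fun_support u v : is_fuzzy_number u -> is_fuzzy_number v ->
  [set x | 0 < fuzzy_add_fun u v x] `<=` minkowski (level u 0) (level v 0).
Proof.
move=> fu fv x /= /fuzzy_add_fun_gt[y [uy vxy]].
exists y; first by rewrite level0; exact: subset_closure.
exists (x - y); first by rewrite level0; exact: subset_closure.
by rewrite addrC subrK.
Qed.

Lemma fuzzy_add_subproof (p q : fuzzy_number) :
  is_fuzzy_number (fuzzy_add_fun p q).
Proof.
have [fp fq] := (fuzzy_numberP p, fuzzy_numberP q).
have lev l : 0 < l <= 1 -> [set x | l <= fuzzy_add_fun p q x] =
    `[level_lo p l + level_lo q l, level_hi p l + level_hi q l]%classic.
  move=> l01; rewrite fuzzy_add_fun_level// minkowski_level_segment//.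
  by case/andP: l01 => /ltW -> ->.
have l00 : 0 <= (0 : R) <= 1 by rewrite lexx ler01.
apply: (@is_fuzzy_number_levels _ (minkowski (level p 0) (level q 0))).
- by move=> x; exact: fuzzy_add_fun01.
- have [x px] := fuzzy_normal fp; have [y qy] := fuzzy_normal fq.
  exists (x + y); apply/le_anti.
  have /andP[_ -> /=] := fuzzy_add_fun01 (x + y) fp fq.
  apply: (le_trans _ (fuzzy_add_fun_ge _ x fp fq)).
  by rewrite addrAC addrN add0r px qy minxx.
- by move=> l /lev ->; exact: interval_closed.
- by move=> l /lev ->; exact: interval_is_interval.
- by rewrite minkowski_level_segment//; exact: segment_compact.
- exact: fuzzy_add_fun_support.
Qed.

Definition fuzzy_add p q := FuzzyNumber (fuzzy_add_subproof p q).

Lemma level_add (p q : fuzzy_number) l : 0 <= l <= 1 ->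
  level (fuzzy_add p q) l = minkowski (level p l) (level q l).
Proof.
have [fp fq] := (fuzzy_numberP p, fuzzy_numberP q).
move=> /andP[l0 l1]; have [->|ln0] := eqVneq l 0; last first.
  have {ln0}l0' : 0 < l by rewrite lt_neqAle eq_sym ln0.
  by rewrite level_gt0// -fuzzy_add_fun_level// l0'.
rewrite [LHS]level0; apply/seteqP; split.
  have cM : closed (minkowski (level p 0) (level q 0)).
    by rewrite minkowski_level_segment ?lexx ?ler01//; exact: interval_closed.
  rewrite (iffLR (closure_id _) cM); apply: closureS.
  exact: fuzzy_add_fun_support.
move=> _ [x + [y + <-]]; rewrite !level0.
move=> /closure_realP clx /closure_realP cly; apply/closure_realP => e e0.
have e20 : 0 < e / 2 by rewrite divr_gt0.
have [x' px xx'] := clx _ e20; have [y' qy yy'] := cly _ e20.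
exists (x' + y').
  apply: (lt_le_trans _ (fuzzy_add_fun_ge _ x' fp fq)).
  by rewrite addrAC addrN add0r lt_min px.
rewrite opprD addrACA (le_lt_trans (ler_normD _ _))//.
by rewrite [ltRHS]splitr ltrD.
Qed.

Lemma fuzzy_addA : associative fuzzy_add.
Proof.
move=> p q r; apply: fuzzy_eq_level => l l01; rewrite !level_add//.
apply/seteqP; split=> _ [x px [y qy <-]].
  by case: qy => {}y qy [z rz <-]; exists (x + y); [exists x => //; exists y|exists z; rewrite ?addrA].
by case: px => {}x px [z rz <-]; exists x => //; exists (z + y); [exists z => //; exists y|rewrite addrA].
Qed.

Lemma fuzzy_addC : commutative fuzzy_add.
Proof.
move=> p q; apply: fuzzy_eq_level => l l01; rewrite !level_add//.
by apply/seteqP; split=> _ [x px [y qy <-]]; exists y => //; exists x => //; rewrite addrC.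
Qed.

Lemma fuzzy_add0 : left_id fuzzy_zero fuzzy_add.
Proof.
move=> p; apply: fuzzy_eq_level => l l01; rewrite level_add// level_zero//.
apply/seteqP; split=> [_ [_ -> [x px <-]]|x px]; first by rewrite add0r.
by exists 0 => //; exists x => //; rewrite add0r.
Qed.

HB.instance Definition _ :=
  GRing.isNmodule.Build fuzzy_number fuzzy_addA fuzzy_addC fuzzy_add0.

Definition hausdorff_dist A B : R :=
  Num.max (sup [set inf [set `|x - y| | y in B] | x in A])
          (sup [set inf [set `|x - y| | x in A] | y in B]).

End fuzzy_numbers.
Arguments fuzzy_number : clear implicits.

Section sampling_operator.
Context {R : realType}.
Implicit Types (a b m d l x : R) (sigma : R -> R) (n : nat)
  (f : R -> fuzzy_number R).

Definition sigmoidal_class m sigma : Prop :=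
  [/\ {homo sigma : x y / x <= y},
      forall x, x <= - m -> sigma x = 0 &
      forall x, m <= x -> sigma x = 1].

Definition kernel_phi m sigma x := sigma (x + m) - sigma (x - m).

Definition step a b n : R := (b - a) / n%:R.

Definition node a b n (k : nat) : R := a + k%:R * step a b n.

(* Functions on [a, b] are represented by functions on R; the operator only
   uses the values at the nodes, and continuity and the modulus below only the
   values on [a, b]. *)
Definition fuzzy_operator a b m sigma n f x : fuzzy_number R :=
  \sum_(k < n.+1)
    fuzzy_scale (kernel_phi m sigma (2 * m / step a b n * (x - node a b n k)))
                (f (node a b n k)).

Definition level_continuous a b f : Prop := forall l, 0 <= l <= 1 ->
  {within `[a, b], continuous (fun x => level_lo (f x) l)} /\
  {within `[a, b], continuous (fun x => level_hi (f x) l)}.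

(* This supremum is over a bounded set when f is level continuous on [a, b]. *)
Definition fuzzy_modulus a b f d l : R :=
  sup [set hausdorff_dist (level (f z.1) l) (level (f z.2) l) |
       z in [set z : R * R | [/\ z.1 \in `[a, b], z.2 \in `[a, b] &
                                 `|z.1 - z.2| < d]]].

End sampling_operator.

(* Main.v *)
Require Import Defs.
From mathcomp Require Import all_boot all_order all_algebra.
From mathcomp Require Import all_classical all_reals all_analysis.
From mathcomp Require Import ring lra.
Import Order.TTheory GRing.Theory Num.Theory.
Import numFieldNormedType.Exports.
Local Open Scope classical_set_scope.
Local Open Scope ring_scope.

(** The weights phi(2m/h (x - x_k)) are nonnegative because sigma is
    nondecreasing, and they sum to 1: the arguments are equally spaced by 2m,
    so the differences sigma(t + m) - sigma(t - m) telescope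
    ([kernel_phi_sum]) down to sigma at a point beyond m minus sigma at a point
    below -m.  A weight can be nonzero only if |x - x_k| < h
    ([kernel_phi_node_support]).

    Since endpoints of levels are additive and positively homogeneous, both
    endpoints of the level of S(f, x) are the averages, with these weights, of
    the endpoints of the levels of the f(x_k).  Hence each endpoint differs
    from that of f(x) by an average of differences taken at nodes closer to x
    than h, and each such difference is at most the modulus.  The passage
    between endpoints and Hausdorff distance is the formula
    [hausdorff_dist_segment].  Level continuity is what makes the supremum in
    the modulus an honest one: endpoints are bounded on [a, b], so the set of
    distances has an upper bound ([hausdorff_dist_le_modulus]). *)

(** * Hausdorff distance of segments *)

Section segments.
Context {R : realType}.
Implicit Types (p q r s : R) (A B : set R).

Definition excess A B : R := sup [set inf [set `|x - y| | y in B] | x in A].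

Lemma hausdorff_dist_excess A B :
  hausdorff_dist A B = Num.max (excess A B) (excess B A).
Proof.
rewrite /hausdorff_dist; congr Num.max; congr sup.
by apply: eq_imagel => y _; congr inf; apply: eq_imagel => x _; rewrite distrC.
Qed.

(** The distance to the segment from r to s vanishes on it and grows away from
    it on both sides, so its supremum over the segment from p to q is read off
    at the endpoints p and q; the 0 accounts for the case of inclusion. *)
Lemma excess_segment p q r s : p <= q -> r <= s ->
  excess `[p, q] `[r, s] = Num.max 0 (Num.max (r - p) (q - s)).
Proof.
move=> pq rs; set M := Num.max 0 _.
have M0 : 0 <= M by rewrite le_max lexx.
have Ml : r - p <= M by rewrite !le_max lexx orbT.
have Mr : q - s <= M by rewrite !le_max lexx !orbT.
have lb x : lbound [set `|x - y| | y in `[r, s]] 0 by move=> _ [y _ <-].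
have ne x : [set `|x - y| | y in `[r, s]] !=set0.
  by exists `|x - r|; exists r => //=; rewrite in_itv /= lexx.
have infle x y : y \in `[r, s] -> inf [set `|x - y| | y in `[r, s]] <= `|x - y|.
  by move=> yrs; apply: ge_inf; [exists 0; exact: lb|exists y].
have dist_le x : x \in `[p, q] -> inf [set `|x - y| | y in `[r, s]] <= M.
  rewrite in_itv /= => /andP[px xq].
  have [xr|rx] := leP x r.
    apply: (le_trans (infle _ r _)); first by rewrite in_itv /= lexx.
    by rewrite ler_norml; apply/andP; split; lra.
  have [xs|sx] := leP x s.
    apply: (le_trans (infle _ x _)); first by rewrite in_itv /= (ltW rx).
    by rewrite subrr normr0.
  apply: (le_trans (infle _ s _)); first by rewrite in_itv /= lexx andbT.
  by rewrite ler_norml; apply/andP; split; lra.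
apply/le_anti/andP; split.
  apply: ge_sup => [|_ [x /= xpq <-]]; last exact: dist_le.
  by exists (inf [set `|p - y| | y in `[r, s]]); exists p => //=; rewrite in_itv /= lexx.
have le_excess x c : x \in `[p, q] ->
    (forall y, y \in `[r, s] -> c <= `|x - y|) -> c <= excess `[p, q] `[r, s].
  move=> xpq cle; apply: (@le_trans _ _ (inf [set `|x - y| | y in `[r, s]])).
    by apply: lb_le_inf; [exact: ne|move=> _ [y yrs <-]; exact: cle].
  apply: ub_le_sup; last by exists x.
  by exists M => _ [z zpq <-]; exact: dist_le.
have ppq : p \in `[p, q] by rewrite in_itv /= lexx.
have qpq : q \in `[p, q] by rewrite in_itv /= lexx andbT.
rewrite !ge_max; apply/and3P; split.
- by apply: (le_excess p).
- apply: (le_excess p) => // y; rewrite in_itv /= => /andP[ry _].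
  by rewrite distrC (le_trans _ (ler_norm _))// lerD2r.
- apply: (le_excess q) => // y; rewrite in_itv /= => /andP[_ ys].
  by rewrite (le_trans _ (ler_norm _))// lerD2l lerN2.
Qed.

Lemma hausdorff_dist_segment p q r s : p <= q -> r <= s ->
  hausdorff_dist `[p, q] `[r, s] = Num.max `|p - r| `|q - s|.
Proof.
move=> pq rs; rewrite hausdorff_dist_excess !excess_segment//.
have pr1 : p - r <= `|p - r| := ler_norm _.
have pr2 : r - p <= `|p - r| by rewrite distrC ler_norm.
have qs1 : q - s <= `|q - s| := ler_norm _.
have qs2 : s - q <= `|q - s| by rewrite distrC ler_norm.
apply/le_anti/andP; split.
  by rewrite !ge_max !le_max normr_ge0 pr1 pr2 qs1 qs2 !orbT.
rewrite ge_max !ler_norml ![- Num.max _ _ <= _]lerNl !opprB.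
by rewrite !le_max !lexx !orbT.
Qed.

End segments.

(** * Endpoints of levels *)

Section endpoints.
Context {R : realType}.
Implicit Types (p q : fuzzy_number R) (c l : R).

Lemma level_endpoints p l (a b : R) : a <= b -> level p l = `[a, b]%classic ->
  level_lo p l = a /\ level_hi p l = b.
Proof.
move=> ab pE; rewrite /level_lo /level_hi pE.
by split; [apply: inf_itv|apply: sup_itv]; rewrite bnd_simp.
Qed.

Lemma level_endpoints0 l : 0 <= l <= 1 ->
  level_lo (0 : fuzzy_number R) l = 0 /\ level_hi (0 : fuzzy_number R) l = 0.
Proof.
move=> l01; apply: level_endpoints => //; rewrite set_itv1.
exact: level_zero.
Qed.

Lemma level_endpointsD p q l : 0 <= l <= 1 ->
  level_lo (p + q) l = level_lo p l + level_lo q l /\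
  level_hi (p + q) l = level_hi p l + level_hi q l.
Proof.
move=> l01; apply: level_endpoints.
  by apply: lerD; apply: level_lo_le_hi => //; exact: fuzzy_numberP.
rewrite -minkowski_level_segment//; try exact: fuzzy_numberP.
exact: level_add.
Qed.

(** A negative factor would exchange the two endpoints. *)
Lemma level_endpointsZ c p l : 0 <= c -> 0 <= l <= 1 ->
  level_lo (fuzzy_scale c p) l = c * level_lo p l /\
  level_hi (fuzzy_scale c p) l = c * level_hi p l.
Proof.
move=> c0 l01; have fp := fuzzy_numberP p; have lohi := level_lo_le_hi fp l01.
apply: level_endpoints; first exact: ler_wpM2l.
rewrite level_scale// (level_segment fp l01).
have [->|cn0] := eqVneq c 0.
  rewrite !mul0r set_itv1; apply/seteqP; split=> x /= => [[y _ <-]|->].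
    by rewrite mul0r.
  by exists (level_lo p l); [rewrite /= in_itv /= lexx|rewrite mul0r].
have {cn0}c0 : 0 < c by rewrite lt_neqAle eq_sym cn0.
apply/seteqP; split=> x /=; rewrite in_itv /=.
  by move=> [y]; rewrite in_itv /= => /andP[ly yh] <-; rewrite !ler_pM2l// ly.
move=> /andP[lx xh]; exists (x / c); last by rewrite mulrC divfK// gt_eqF.
by rewrite in_itv /= ler_pdivlMr// ler_pdivrMr// ![_ * c]mulrC lx.
Qed.

Lemma level_endpoints_sum (I : finType) (w : I -> R) (p : I -> fuzzy_number R) l :
  (forall i, 0 <= w i) -> 0 <= l <= 1 ->
  level_lo (\sum_i fuzzy_scale (w i) (p i)) l = \sum_i w i * level_lo (p i) l /\
  level_hi (\sum_i fuzzy_scale (w i) (p i)) l = \sum_i w i * level_hi (p i) l.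
Proof.
move=> w0 l01; split.
  transitivity (\sum_i level_lo (fuzzy_scale (w i) (p i)) l).
    apply: (big_morph (fun q : fuzzy_number R => level_lo q l)) => [q r|].
      by case: (level_endpointsD q r l l01).
    by case: (level_endpoints0 l l01).
  by apply: eq_bigr => i _; case: (level_endpointsZ (w i) (p i) l (w0 i) l01).
transitivity (\sum_i level_hi (fuzzy_scale (w i) (p i)) l).
  apply: (big_morph (fun q : fuzzy_number R => level_hi q l)) => [q r|].
    by case: (level_endpointsD q r l l01).
  by case: (level_endpoints0 l l01).
by apply: eq_bigr => i _; case: (level_endpointsZ (w i) (p i) l (w0 i) l01).
Qed.

Lemma hausdorff_dist_level p q l : 0 <= l <= 1 ->
  hausdorff_dist (level p l) (level q l) =
  Num.max `|level_lo p l - level_lo q l| `|level_hi p l - level_hi q l|.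
Proof.
move=> l01; have [fp fq] := (fuzzy_numberP p, fuzzy_numberP q).
rewrite (level_segment fp l01) (level_segment fq l01).
by rewrite hausdorff_dist_segment//; exact: level_lo_le_hi.
Qed.

End endpoints.

(** * The modulus of continuity *)

Section modulus.
Context {R : realType}.
Implicit Types (a b d l x y : R) (g : R -> R) (f : R -> fuzzy_number R).

Lemma within_continuous_osc_bounded a b g : a <= b ->
  {within `[a, b], continuous g} ->
  exists M, forall x y, x \in `[a, b] -> y \in `[a, b] -> `|g x - g y| <= M.
Proof.
move=> ab gc; have [u _ gu] := EVT_max ab gc; have [v _ gv] := EVT_min ab gc.
exists (g u - g v) => x y xab yab.
have := gu x xab; have := gv x xab; have := gu y yab; have := gv y yab.
by move=> *; rewrite ler_norml; apply/andP; split; lra.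
Qed.

(** As [sup] takes a junk value on unbounded sets, this needs the set of
    distances to be bounded above: endpoints attain their extrema on the compact
    [a, b], so their oscillation there is finite. *)
Lemma hausdorff_dist_le_modulus a b f d l x y : a <= b ->
  level_continuous a b f -> 0 <= l <= 1 ->
  x \in `[a, b] -> y \in `[a, b] -> `|x - y| < d ->
  hausdorff_dist (level (f x) l) (level (f y) l) <= fuzzy_modulus a b f d l.
Proof.
move=> ab fc l01 xab yab xyd; have [loc hic] := fc l l01.
have [M loM] := within_continuous_osc_bounded _ _ _ ab loc.
have [N hiN] := within_continuous_osc_bounded _ _ _ ab hic.
apply: ub_le_sup; last by exists (x, y).
exists (Num.max M N) => _ [[u v] [/= uab vab _] <-].
by rewrite hausdorff_dist_level// ge_max !le_max loM// hiN// orbT.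
Qed.

End modulus.

(** * The kernel *)

Section kernel.
Context {R : realType}.
Implicit Types (a b m t x y : R) (sigma : R -> R) (n k : nat).

Lemma kernel_phi_ge0 m sigma t : 0 < m -> sigmoidal_class m sigma ->
  0 <= kernel_phi m sigma t.
Proof.
by move=> m0 [sigma_homo _ _]; rewrite subr_ge0; apply: sigma_homo; lra.
Qed.

Lemma kernel_phi_support m sigma t : 0 < m -> sigmoidal_class m sigma ->
  kernel_phi m sigma t != 0 -> `|t| < 2 * m.
Proof.
move=> m0 [_ sigma0 sigma1]; apply: contra_neqT; rewrite -leNgt ler_normr /kernel_phi.
case/orP => tm; first by rewrite !sigma1 ?subrr//; lra.
by rewrite !sigma0 ?subrr//; lra.
Qed.

(** The sum telescopes to sigma (t + m) - sigma (t - 2mn - m), and the bounds on t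
    put the first argument beyond m and the second below -m. *)
Lemma kernel_phi_sum m sigma n t : sigmoidal_class m sigma ->
  0 <= t <= 2 * m * n%:R ->
  \sum_(k < n.+1) kernel_phi m sigma (t - 2 * m * k%:R) = 1.
Proof.
move=> [_ sigma0 sigma1] /andP[t0 tn].
(* Both boundary values of one term are values of this sequence, since
   consecutive arguments differ by 2 m. *)
pose s k := - sigma (t + m - 2 * m * k%:R).
transitivity (\sum_(0 <= k < n.+1) (s k.+1 - s k)).
  rewrite big_mkord; apply: eq_bigr => k _; rewrite /kernel_phi /s opprK addrC.
  by congr (- sigma _ + sigma _); rewrite ?mulrS; ring.
rewrite telescope_sumr// /s mulr0 subr0 (sigma1 (t + m)); last by lra.
rewrite sigma0 ?oppr0 ?opprK ?add0r//.
by rewrite -[n.+1%:R]natr1; lra.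
Qed.

Lemma step_gt0 a b n : a < b -> (0 < n)%N -> 0 < step a b n.
Proof. by move=> ab n0; rewrite divr_gt0 ?subr_gt0// ltr0n. Qed.

Lemma node_in_itv a b n k : a < b -> (0 < n)%N -> (k <= n)%N ->
  node a b n k \in `[a, b].
Proof.
move=> ab n0 kn; have n0' : 0 < n%:R :> R by rewrite ltr0n.
have h0 := ltW (step_gt0 a b n ab n0).
have nh : n%:R * step a b n = b - a by rewrite /step mulrC divfK// gt_eqF.
have : k%:R * step a b n <= n%:R * step a b n by rewrite ler_wpM2r// ler_nat.
have : 0 <= k%:R * step a b n by rewrite mulr_ge0.
rewrite nh in_itv /= /node => *; apply/andP; split; lra.
Qed.

Lemma kernel_phi_node_support a b m sigma n x y : a < b -> 0 < m ->
  (0 < n)%N -> sigmoidal_class m sigma ->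
  kernel_phi m sigma (2 * m / step a b n * (x - y)) != 0 ->
  `|x - y| < step a b n.
Proof.
move=> ab m0 n0 sm /(kernel_phi_support _ _ _ m0 sm).
have h0 := step_gt0 a b n ab n0; have m20 : 0 < 2 * m by lra.
have c0 : 0 < 2 * m / step a b n by rewrite divr_gt0.
by rewrite normrM (gtr0_norm c0) mulrAC ltr_pdivrMr// ltr_pM2l.
Qed.

(** In the variable t = 2m/h (x - a) the interval [a, b] becomes [0, 2mn] and the
    nodes become the multiples of 2m. *)
Lemma kernel_phi_node_sum a b m sigma n x : a < b -> 0 < m ->
  (0 < n)%N -> sigmoidal_class m sigma -> x \in `[a, b] ->
  \sum_(k < n.+1)
    kernel_phi m sigma (2 * m / step a b n * (x - node a b n k)) = 1.
Proof.
move=> ab m0 n0 sm; rewrite in_itv /= => /andP[ax xb].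
have h0 := step_gt0 a b n ab n0; have n0' : 0 < n%:R :> R by rewrite ltr0n.
have c0 : 0 < 2 * m / step a b n by rewrite divr_gt0//; lra.
have nh : n%:R * step a b n = b - a by rewrite /step mulrC divfK// gt_eqF.
rewrite -[RHS](kernel_phi_sum m sigma n (2 * m / step a b n * (x - a)))//.
  apply: eq_bigr => k _; congr kernel_phi; rewrite /node.
  by field; rewrite gt_eqF.
rewrite mulr_ge0 ?(ltW c0) ?subr_ge0//=.
have -> : 2 * m * n%:R = 2 * m / step a b n * (n%:R * step a b n).
  by field; rewrite gt_eqF.
by rewrite ler_pM2l// nh lerD2r.
Qed.

End kernel.

(** * Weighted averages *)

(** A value y differs from a weighted average of the g i by the average of the
    y - g i; only indices of nonzero weight contribute. *)
Lemma weighted_average_dist_le (R : realType) (I : finType) (w g : I -> R)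
    (y M : R) :
  (forall i, 0 <= w i) -> \sum_i w i = 1 ->
  (forall i, w i != 0 -> `|y - g i| <= M) ->
  `|y - \sum_i w i * g i| <= M.
Proof.
move=> w0 w1 gM; rewrite -[y]mul1r -w1 mulr_suml -sumrB.
apply: (le_trans (ler_norm_sum _ _ _)); rewrite -[M]mul1r -w1 mulr_suml.
apply: ler_sum => i _; rewrite -mulrBr normrM (ger0_norm (w0 i)).
have [->|wi] := eqVneq (w i) 0; first by rewrite !mul0r.
by rewrite ler_wpM2l// gM.
Qed.

Theorem theorem3p3 (R : realType) (a b m : R) (sigma : R -> R)
    (f0 : R -> fuzzy_number R) :
  a < b -> 0 < m -> sigmoidal_class m sigma -> level_continuous a b f0 ->
  forall l : R, 0 <= l <= 1 ->
  forall n : nat, (1 <= n)%N ->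
  forall x : R, x \in `[a, b] ->
  hausdorff_dist (level (f0 x) l)
                 (level (fuzzy_operator a b m sigma n f0 x) l)
    <= fuzzy_modulus a b f0 (step a b n) l.
Proof.
move=> ab m0 sm fc l l01 n n0 x xab.
pose w (k : 'I_n.+1) :=
  kernel_phi m sigma (2 * m / step a b n * (x - node a b n k)).
have w0 k : 0 <= w k by exact: kernel_phi_ge0.
have w1 : \sum_k w k = 1 by exact: kernel_phi_node_sum.
have near_node k : w k != 0 ->
    hausdorff_dist (level (f0 x) l) (level (f0 (node a b n k)) l)
      <= fuzzy_modulus a b f0 (step a b n) l.
  move=> /(kernel_phi_node_support _ _ _ _ _ _ _ ab m0 n0 sm) xk.
  apply: hausdorff_dist_le_modulus => //; first exact: ltW.
  by apply: node_in_itv => //; rewrite -ltnS.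
have [loS hiS] := level_endpoints_sum _ w (fun k => f0 (node a b n k)) l w0 l01.
rewrite hausdorff_dist_level// /fuzzy_operator loS hiS ge_max.
by apply/andP; split; apply: weighted_average_dist_le => // k /near_node;
  rewrite hausdorff_dist_level// ge_max => /andP[].
Qed.
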